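(* Suppose $M$ is a function on $\Sigma_A$ taking values in the set of all $d\times d$ non-negative matrices such that: (H1) there are matrices $M_1,\dots,M_m$ with $M(x)=M_i$ whenever $x\in[i]$, $i=1,\dots,m$; (H2) there exists an integer $r>0$ such that for any $i,j\in\{1,\dots,m\}$, $$\sum_{k=1}^r\ \sum_{K\in\Sigma_{A,k;i,j}}M_K>\mathbf{0}$$ (all entries strictly positive). For $\alpha\in\mathbb{R}$ let $$E(\alpha)=\Big\{J=(j_i)\in\Sigma_A:\ \lim_{n\to\infty}\frac{\log\|M_{j_1}\cdots M_{j_n}\|}{n}=\alpha\Big\}.$$ Then for any $\alpha=P'(q)$ with $q>0$, $$\dim_H E(\alpha)=\frac{1}{\log m}\big(-\alpha q+P(q)\big),$$ where $\dim_H$ denotes the Hausdorff dimension.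
   Context: Let $m\ge 2$, $\Sigma=\{1,\dots,m\}^{\mathbb{N}}$, with the metric $d(x,y)=m^{-n}$ for $x\neq y$, where $n$ is the smallest $k$ with $x_k\ne y_k$; Hausdorff dimension is taken with respect to this metric. Let $A$ be an $m\times m$ matrix with entries $0$ or $1$, assumed primitive (some power $A^p$ has all entries strictly positive). $\Sigma_A=\{x\in\Sigma: A_{x_k,x_{k+1}}=1\ \text{for all } k\}$ is the associated subshift of finite type. $\Sigma_{A,n}$ is the set of admissible words $J=j_1\cdots j_n$ of length $n$ over $\{1,\dots,m\}$ (that is, $A_{j_k,j_{k+1}}=1$ for $1\le k<n$), and $[J]=\{x\in\Sigma_A: x_i=j_i,\ 1\le i\le n\}$ is the cylinder set. $\Sigma_{A,k;i,j}$ is the set of all $K\in\Sigma_{A,k}$ such that the concatenation $iKj$ lies in $\Sigma_{A,k+2}$. For a word $J=j_1\cdots j_n$, $M_J=M_{j_1}\cdots M_{j_n}$. The matrix norm is $\|B\|=\mathbf{1}^tB\mathbf{1}$ with $\mathbf{1}^t=(1,\dots,1)$ (the sum of all entries); $\log 0=-\infty$. The pressure function, for $q>0$, is $$P(q)=\lim_{n\to\infty}\frac1n\log\sum_{J\in\Sigma_{A,n}}\|M_J\|^q,$$ the limit existing in this setting; $P$ is differentiable at every $q>0$. *)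

(* Defs.v *)
From HB Require Import structures.
From mathcomp Require Import all_boot all_order all_algebra.
From mathcomp Require Import all_classical all_reals all_analysis.

Set Implicit Arguments.
Unset Strict Implicit.
Unset Printing Implicit Defensive.

Import Order.TTheory GRing.Theory Num.Theory.
Import numFieldNormedType.Exports.

Local Open Scope classical_set_scope.
Local Open Scope ring_scope.

Section HausdorffDimension.
Context {R : realType} {T : metricType R}.
Implicit Types (U E : set T) (s delta : R).
Local Open Scope ereal_scope.

(* The extra point 0 makes [diam set0 = 0] (and not -oo). *)
Definition diam U : \bar R :=
  ereal_sup (0 |` [set (mdist p.1 p.2)%:E | p in U `*` U]).

(* The empty set is singled out because [0 `^ 0 = 1]: the value at [s = 0] is
   then 1 on every nonempty set, and 0 on the empty set. *)
Definition hausdorff_weight s U : \bar R :=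
  if U == set0 then 0 else diam U `^ s.

Definition hausdorff_content s delta E : \bar R :=
  ereal_inf [set \sum_(0 <= i <oo) hausdorff_weight s (F i)
            | F in [set F : (set T)^nat
                   | (forall i, diam (F i) <= delta%:E) /\
                     E `<=` \bigcup_i F i]].

Definition hausdorff_measure s E : \bar R :=
  ereal_sup [set hausdorff_content s delta E | delta in [set delta | (0 < delta)%R]].

Definition hausdorff_dim E : \bar R :=
  ereal_inf [set s%:E | s in [set s | (0 <= s)%R /\ hausdorff_measure s E = 0]].

End HausdorffDimension.

(* The alphabet {1, ..., m} is ['I_m] and coordinates are indexed from 0. The
   phantom parameter [R] is the field in which the distance takes its values. *)
Definition full_shift (R : realType) (m : nat) : Type := nat -> 'I_m.

HB.instance Definition _ (R : realType) (m : nat) :=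
  Choice.copy (full_shift R m) (nat -> 'I_m).

Section ShiftDistance.
Context {R : realType} {m : nat}.
Implicit Types x y z : full_shift R m.

(* With coordinates indexed from 0, the first disagreement at index [k] is the
   one at position [k.+1] in the numbering x_1, x_2, ... *)
Definition shift_dist x y : R :=
  if pselect (exists k, x k != y k) is left h then m%:R ^- (ex_minn h).+1
  else 0.

Lemma shift_dist_ge0 x y : 0 <= shift_dist x y.
Proof.
by rewrite /shift_dist; case: pselect => // h; rewrite invr_ge0 exprn_ge0.
Qed.

Lemma shift_distxx x : shift_dist x x = 0.
Proof.
rewrite /shift_dist; case: pselect => // h.
by exfalso; case: h => k; rewrite eqxx.
Qed.

Lemma shift_dist_ge x y k : x k != y k -> m%:R ^- k.+1 <= shift_dist x y.
Proof.
move=> xyk; rewrite /shift_dist; case: pselect => [h|[]]; last by exists k.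
have m0 : (0 < m)%N by exact: leq_ltn_trans (leq0n (x 0%N)) (ltn_ord _).
case: ex_minnP => n _ /(_ _ xyk) nk.
by rewrite lef_pV2 ?posrE ?exprn_gt0 ?ltr0n// ler_weXn2l// ler1n.
Qed.

Lemma shift_dist_eq0 x y : shift_dist x y = 0 -> x = y.
Proof.
have m0 : (0 < m)%N by exact: leq_ltn_trans (leq0n (x 0%N)) (ltn_ord _).
move=> xy0; apply/funext => k; apply/eqP; apply: contraT => /shift_dist_ge.
by rewrite xy0 leNgt invr_gt0 exprn_gt0// ltr0n.
Qed.

Lemma shift_dist_sym x y : shift_dist x y = shift_dist y x.
Proof.
rewrite /shift_dist; case: pselect => h; case: pselect => h' //.
- by congr (_ ^- _.+1); apply: eq_ex_minn => k; rewrite eq_sym.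
- by case: h' ; case: h => k xyk; exists k; rewrite eq_sym.
- by case: h ; case: h' => k xyk; exists k; rewrite eq_sym.
Qed.

Lemma shift_dist_triangle y x z :
  shift_dist x z <= shift_dist x y + shift_dist y z.
Proof.
rewrite {1}/shift_dist; case: pselect => [h|_]; last first.
  by rewrite addr_ge0 ?shift_dist_ge0.
case: ex_minnP => k xzk _; have [xyk|xyk] := eqVneq (x k) (y k).
  by rewrite ler_wpDl ?shift_dist_ge0// shift_dist_ge// -xyk.
by rewrite ler_wpDr ?shift_dist_ge0// shift_dist_ge.
Qed.

End ShiftDistance.

HB.instance Definition _ (R : realType) (m : nat) :=
  isMetric.Build R (full_shift R m) (@shift_distxx R m) (@shift_dist_eq0 R m)
    (@shift_dist_sym R m) (@shift_dist_triangle R m).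

Section Subshift.
Context {R : realType} {m : nat}.
Implicit Type A : 'M[nat]_m.

Definition zero_one_mx A := forall i j, A i j = 0%N \/ A i j = 1%N.

Definition primitive_mx A := exists p : nat, forall i j, (0 < (A ^+ p) i j)%N.

Definition subshift A : set (full_shift R m) :=
  [set x | forall k, A (x k) (x k.+1) = 1%N].

Definition words A n : {set n.-tuple 'I_m} :=
  [set J : n.-tuple 'I_m | sorted (fun i j => A i j == 1%N) J]%SET.

Definition words_between A k (i j : 'I_m) : {set k.-tuple 'I_m} :=
  [set K in words A k | [tuple of i :: rcons K j] \in words A k.+2]%SET.

Definition cylinder A n (J : n.-tuple 'I_m) :
    set (full_shift R m) :=
  [set x | subshift A x /\ forall k : 'I_n, x k = tnth J k].

End Subshift.

Section MatrixProducts.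
Context {R : realType} {m d : nat}.
Implicit Types (A : 'M[nat]_m) (Ms : 'I_m -> 'M[R]_d).

Definition word_mx Ms (J : seq 'I_m) : 'M[R]_d := \prod_(i <- J) Ms i.

Definition mx_norm1 (B : 'M[R]_d) : R := \sum_i \sum_j B i j.

(* [lne] is the extended logarithm, with [lne 0 = -oo]. For [d > 0] the limit
   is finite under the positivity hypothesis of the theorem, and [fine] only
   turns it into a real number. *)
Definition pressure A Ms (q : R) : R :=
  fine (limn (fun n : nat =>
    (n%:R^-1)%:E *
      lne (\sum_(J in words A n) mx_norm1 (word_mx Ms J) `^ q)%:E)%E).

Definition level_set A Ms (alpha : R) : set (full_shift R m) :=
  [set x | subshift A x /\
    ((n%:R^-1)%:E * lne (mx_norm1 (word_mx Ms (mkseq x n)))%:E)%E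
      @[n --> \oo] --> alpha%:E].

End MatrixProducts.

(* Main.v *)
Require Import Defs.
From mathcomp Require Import all_boot all_order all_algebra.
From mathcomp Require Import all_classical all_reals all_analysis.
From mathcomp Require Import ring lra.
Import Order.TTheory GRing.Theory Num.Theory.
Import numFieldNormedType.Exports.
Set Implicit Arguments.
Unset Strict Implicit.
Unset Printing Implicit Defensive.
Local Open Scope classical_set_scope.
Local Open Scope ring_scope.

(** The dimension is computed without constructing an equilibrium measure: all
    that is used of it is an upper bound for the mass of cylinders, and that
    bound is already available for the finite distributions on words.

    Write [|M_J|] for the norm of the product of matrices along a word [J] and
    [Z q n] for the sum of [|M_J| ^ q] over admissible words of length [n].
    The norm is submultiplicative, and the positivity hypothesis lets any two
    words be joined by a short word at the cost of a bounded factor, so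
    [Z q n * Z q k] and [Z q (n + k)] agree up to a constant
    ([partition_sum_submul], [partition_sum_supmul]). Hence the limit [P q]
    exists and [exp (n P q) <= Z q n <= C exp (n P q)] ([pressure_bounds]).

    Upper bound. A point of the level set has prefixes with
    [|M_J| >= exp (n (alpha - e))] for every large [n], and there are at most
    [Z q n * exp (- n q (alpha - e))] such words, that is about
    [exp (n (P q - q alpha))]. Their cylinders have diameter at most [m ^- n]
    ([level_set_measure0]).

    Lower bound. Give a word [J] the weight [|M_J| ^ q * exp (- |J| P q)]. If
    every point of the subshift has a prefix in a set [W] of words, then by
    compactness all long words have one, and comparing with the distribution
    [|M_K| ^ q / Z q N] on words of a large length [N] shows that the weights
    of the elements of [W] add up to at least a constant ([gibbs_cover]).
    Differentiability of [P] at [q] gives a Chernoff estimate: comparing [P q]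
    with [P (q + t)] for small [t] of both signs, the words of length [n] whose
    norm is not between [exp (n (alpha - e))] and [exp (n (alpha + e))] have
    exponentially small total weight ([deviant_mass]). Discarding the long
    deviant words for every [e = 1 / k], with total weight at most half of the
    constant above, leaves a set of points that lies inside the level set, and
    any cover of it by cylinders still carries the other half of the weight
    ([typical_cover]).
    The cylinders that meet it have weight at most about
    [exp (- n (P q - q alpha))], so the sum of the [s]-th powers of their
    diameters stays away from [0] as soon as [s * ln m < P q - q alpha]
    ([level_set_measure_neq0]). *)

(** * Real analysis *)

Section RealAnalysis.
Context {R : realType}.

Lemma exists_nat_mul_ge (kappa y : R) : 0 < kappa ->
  exists n0, forall n, (n0 <= n)%N -> y <= n%:R * kappa.
Proof.
move=> k0; exists (Num.bound `|y / kappa|) => n nn0.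
rewrite -ler_pdivrMr// (le_trans (ler_norm _))//.
by rewrite (le_trans (ltW (archi_boundP (normr_ge0 _))))// ler_nat.
Qed.

Lemma sum_expr_tail (rho : R) n0 N : 0 <= rho -> rho < 1 ->
  \sum_(n0 <= n < N) rho ^+ n <= rho ^+ n0 / (1 - rho).
Proof.
move=> r0 r1; have r1' : 0 < 1 - rho by rewrite subr_gt0.
rewrite ler_pdivlMr//.
have [nN|Nn] := leqP n0 N; last first.
  by rewrite big_geq ?mul0r ?exprn_ge0// ltnW.
suff -> : (\sum_(n0 <= n < N) rho ^+ n) * (1 - rho) = rho ^+ n0 - rho ^+ N.
  by rewrite gerBl exprn_ge0.
elim: N nN => [|N IH].
  by rewrite leqn0 => /eqP ->; rewrite big_geq// mul0r subrr.
rewrite leq_eqVlt => /predU1P[->|].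
  by rewrite big_geq// mul0r subrr.
rewrite ltnS => nN; rewrite big_nat_recr//= mulrDl IH// exprS; ring.
Qed.

Lemma geometric_tail (kappa C eta : R) : 0 < kappa -> 0 < eta ->
  exists n0, forall N, \sum_(n0 <= n < N) C * expR (- (n%:R * kappa)) <= eta.
Proof.
move=> k0 e0; pose rho := expR (- kappa).
have r0 : 0 < rho by exact: expR_gt0.
have r1 : rho < 1 by rewrite expR_lt1 oppr_lt0.
have r1' : 0 < 1 - rho by rewrite subr_gt0.
have cr : `|rho| < 1 by rewrite gtr0_norm.
have c0 : 0 < `|C| + 1 by rewrite ltr_wpDl.
have /cvgrPdist_le/(_ (eta * (1 - rho) / (`|C| + 1))) := cvg_expr cr.
rewrite !divr_gt0 ?mulr_gt0// => /(_ isT)[n0 _ /(_ n0 (leqnn n0))].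
rewrite sub0r normrN ger0_norm ?exprn_ge0 ?(ltW r0)// => hn0.
exists n0 => N.
rewrite (le_trans (y := \sum_(n0 <= n < N) (`|C| + 1) * rho ^+ n))//.
  apply: ler_sum => n _; rewrite -expRM_natl mulrN ler_wpM2r ?expR_ge0//.
  by rewrite (le_trans (ler_norm _))// lerDl.
rewrite -mulr_sumr -ler_pdivlMl//.
rewrite (le_trans (sum_expr_tail _ _ (ltW r0) r1))// ler_pdivrMr//.
by apply: (le_trans hn0); rewrite mulrC mulrA.
Qed.

Lemma sum_pow2_le (I : nat) : \sum_(0 <= i < I) 2^-1 ^+ i.+1 <= 1 :> R.
Proof.
suff -> : \sum_(0 <= i < I) 2^-1 ^+ i.+1 = 1 - 2^-1 ^+ I :> R.
  by rewrite gerBl exprn_ge0// invr_ge0.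
elim: I => [|I IH]; first by rewrite big_geq// expr0 subrr.
by rewrite big_nat_recr//= IH exprS; field.
Qed.

(** Superadditivity up to [D] along multiples of [n] and subadditivity along
    multiples of [k], compared at [n * k], give
    [(u n - D) / n <= u k / k] for all positive [n] and [k]; any number that
    separates the two families is the limit, with an error bounded by [D]. *)
Lemma almost_additive (u : nat -> R) (D : R) :
  (forall n k, u (n + k)%N <= u n + u k) ->
  (forall n k, u n + u k <= u (n + k)%N + D) ->
  exists P, forall n, n%:R * P <= u n <= n%:R * P + D.
Proof.
move=> hsub hsup.
have sub_mul k n : (0 < n)%N -> u (n * k)%N <= n%:R * u k.
  elim: n => // -[_ _|n /(_ isT) IH _]; first by rewrite mul1n mul1r.
  rewrite mulSn -(natr1 n.+1) mulrDl mul1r.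
  by rewrite (le_trans (hsub _ _))// [leRHS]addrC lerD.
have sup_mul n k : k%:R * u n <= u (n * k)%N + k%:R * D.
  elim: k => [|k IH].
    by rewrite muln0 !mul0r addr0; have := hsub 0%N 0%N; rewrite addn0; lra.
  rewrite mulnS -(natr1 k) !mulrDl !mul1r.
  have := hsup n (n * k)%N; lra.
(* both sides are compared with [u (n * k) / (n * k)] *)
have cmp n k : (0 < n)%N -> (0 < k)%N -> (u n - D) / n%:R <= u k / k%:R.
  move=> n0 k0; rewrite ler_pdivrMr ?ltr0n// mulrAC ler_pdivlMr ?ltr0n//.
  by have := sub_mul k n n0; have := sup_mul n k; lra.
(* the limit is the supremum of the lower family *)
pose B := [set (u n.+1 - D) / n.+1%:R | n in [set: nat]].
have Bub n : ubound B (u n.+1 / n.+1%:R) by move=> _ [k _ <-]; exact: cmp.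
have Bsup : has_sup B.
  by split; [exists ((u 1%N - D) / 1%:R), 0%N | exists (u 1%N / 1%:R); exact: Bub].
exists (sup B) => -[|n].
  rewrite mul0r; have := hsub 0%N 0%N; have := hsup 0%N 0%N.
  by rewrite addn0 => ? ?; apply/andP; split; lra.
apply/andP; split.
  by rewrite mulrC -ler_pdivlMr ?ltr0n//; apply: ge_sup (Bub n); case: Bsup.
rewrite -lerBlDr mulrC -ler_pdivrMr ?ltr0n//.
by apply: ub_le_sup; [case: Bsup | exists n].
Qed.

(** Convergence of the extended normalized logarithm is restated as two-sided
    exponential growth, so that a sequence with vanishing terms and the value
    [-oo] of its logarithm need no separate treatment afterwards. *)
Lemma cvg_lne_growth (u : nat -> R) (alpha : R) : (forall n, 0 <= u n) ->
  ((n%:R^-1)%:E * lne (u n)%:E)%E @[n --> \oo] --> alpha%:E <->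
  (forall e, 0 < e -> exists n0, forall n, (n0 <= n)%N ->
     expR (n%:R * (alpha - e)) <= u n <= expR (n%:R * (alpha + e))).
Proof.
move=> u0; split => [h e e0|h].
  have : \forall n \near \oo, ((n%:R^-1)%:E * lne (u n)%:E \is a fin_num)%E
      /\ `|alpha - fine ((n%:R^-1)%:E * lne (u n)%:E)%E| <= e.
    move/fine_cvgP: h => [h1 /cvgrPdist_le/(_ _ e0) h2].
    by near=> n; split; near: n.
  move=> [n0 _ hn0]; exists n0.+1 => n nn0.
  have n_gt0 : (0 < n)%N by exact: leq_ltn_trans nn0.
  have [] := hn0 n (ltnW nn0).
  have [un0|un0] := leP (u n) 0.
    rewrite le0_lneNy ?lee_fin// gt0_muleNy ?lte_fin ?invr_gt0 ?ltr0n//.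
  rewrite lne_EFin// -EFinM => _; rewrite /= ler_distlC => /andP[].
  rewrite ler_pdivlMl ?ltr0n// ler_pdivrMl ?ltr0n// => h1 h2.
  by rewrite -{1 2}(@lnK R (u n)) ?posrE// !ler_expR h1 h2.
apply/fine_cvgP.
have H e : 0 < e -> \forall n \near \oo,
    ((n%:R^-1)%:E * lne (u n)%:E \is a fin_num)%E
      /\ `|alpha - fine ((n%:R^-1)%:E * lne (u n)%:E)%E| <= e.
  move=> /h[n0 hn0]; exists n0.+1 => // n nn0.
  have n_gt0 : (0 < n)%N := leq_ltn_trans (leq0n _) nn0.
  have /andP[h1 h2] := hn0 n (ltnW nn0).
  have un0 : 0 < u n by apply: lt_le_trans h1; exact: expR_gt0.
  rewrite /mkset lne_EFin// -EFinM; split => //=.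
  rewrite ler_distlC ler_pdivlMl ?ltr0n// ler_pdivrMl ?ltr0n//.
  by rewrite -(@lnK R (u n)) ?posrE// !ler_expR in h1 h2; rewrite h1.
split; first by have [n0 _ hn] := H 1 ltr01; exists n0 => // n /hn[].
by apply/cvgrPdist_le => e /H[n0 _ hn]; exists n0 => // n /hn[].
Unshelve. all: by end_near.
Qed.

(** Each term is at most the [q]-th root of the sum of all [q]-th powers. This
    replaces convexity for [q] above and below [1] alike, at the price of a
    factor that only depends on the number of terms. *)
Lemma powR_sum_le (I : Type) (s : seq I) (F : I -> R) (q : R) : 0 < q ->
  (forall i, 0 <= F i) ->
  (\sum_(i <- s) F i) `^ q <= (size s)%:R `^ q * \sum_(i <- s) F i `^ q.
Proof.
move=> q0 F0; set T := \sum_(i <- s) F i `^ q.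
have T0 : 0 <= T by apply: sumr_ge0 => i _; exact: powR_ge0.
  have Bq : (T `^ q^-1) `^ q = T by rewrite -powRrM mulVf ?gt_eqF// powRr1.
  rewrite -{1}Bq -powRM ?powR_ge0// ge0_ler_powR ?(ltW q0) ?nnegrE//.
  - exact: sumr_ge0.
  - by rewrite mulr_ge0 ?powR_ge0.
  have: T <= (T `^ q^-1) `^ q by rewrite Bq.
  rewrite {1}/T; move: (T `^ q^-1) (powR_ge0 T q^-1) => B B0.
  elim: s {T T0 Bq} => [|i s IH]; first by rewrite !big_nil mul0r.
  rewrite !big_cons => hB; rewrite /= -natr1 mulrDl mul1r [leRHS]addrC.
  have [h1 h2] : F i `^ q <= B `^ q /\ \sum_(j <- s) F j `^ q <= B `^ q.
    split; apply: le_trans hB; rewrite (lerDr, lerDl) ?sumr_ge0// => *;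
      exact: powR_ge0.
  rewrite lerD ?IH// leNgt; apply: contraTN h1 => FB.
  by rewrite -ltNge gt0_ltr_powR// nnegrE.
Qed.

Lemma is_derive_linear (f : R -> R) (q a : R) : is_derive q 1 f a ->
  forall e, 0 < e -> exists2 delta, 0 < delta &
    forall t, `|t| < delta -> `|f (q + t) - f q - t * a| <= e * `|t|.
Proof.
move=> [df <-] e e0.
have : h^-1 *: ((f \o shift q) (h *: 1) - f q) @[h --> 0^'] --> 'D_1 f q.
  exact: df.
move=> /cvgrPdist_le/(_ e e0); move=> /nbhs_ballP[delta /= d0 hd].
exists delta => // t td; have [->|t0] := eqVneq t 0.
  by rewrite addr0 subrr mul0r subr0 !normr0 mulr0.
have := hd t; rewrite /ball /= sub0r normrN => /(_ td t0).
rewrite /= /shift /= !scaler1 (addrC t).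
have -> : f (q + t) - f q - t * 'D_1 f q =
  - (t * ('D_1 f q - t^-1 *: (f (q + t) - f q))).
  by rewrite /GRing.scale /= mulrBr mulVKf//; ring.
by rewrite normrN normrM mulrC; apply: ler_wpM2r.
Qed.
End RealAnalysis.

(** * Sums over words, and compactness of the subshift *)

Section WordSums.
Context {R : realType} {m : nat}.
Implicit Types (F G : seq 'I_m -> R) (n k : nat).

(** Functions on sequences rather than on tuples are summed, so that sums over
    words of different lengths can be compared by concatenation. *)
Definition word_sum n F : R := \sum_(J : n.-tuple 'I_m) F J.

Lemma word_sum0 F : word_sum 0 F = F [::].
Proof.
rewrite /word_sum (bigD1 [tuple])//= big1 ?addr0// => J /negP[].
by apply/eqP; exact: tuple0.
Qed.

Lemma word_sumS n F : word_sum n.+1 F = \sum_i word_sum n (fun J => F (i :: J)).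
Proof.
rewrite /word_sum pair_big /=.
rewrite (reindex (fun p : 'I_m * n.-tuple 'I_m => [tuple of p.1 :: p.2])) //=.
exists (fun t => (thead t, [tuple of behead t])) => [[i J] _|J _] /=.
  by congr pair; apply/val_inj.
by rewrite [RHS]tuple_eta; apply/val_inj.
Qed.

Lemma eq_word_sum n F G : (forall J, size J = n -> F J = G J) ->
  word_sum n F = word_sum n G.
Proof. by move=> FG; apply: eq_bigr => J _; rewrite FG ?size_tuple. Qed.

Lemma word_sum_cat n k F :
  word_sum (n + k) F = word_sum n (fun I => word_sum k (fun J => F (I ++ J))).
Proof.
elim: n F => [|n IH] F; first by rewrite word_sum0.
by rewrite addSn !word_sumS; apply: eq_bigr => i _; rewrite IH.
Qed.

Lemma ler_word_sum n F G : (forall J, size J = n -> F J <= G J) ->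
  word_sum n F <= word_sum n G.
Proof. by move=> FG; apply: ler_sum => J _; rewrite FG ?size_tuple. Qed.

Lemma word_sum_ge0 n F : (forall J, size J = n -> 0 <= F J) -> 0 <= word_sum n F.
Proof. by move=> F0; apply: sumr_ge0 => J _; rewrite F0 ?size_tuple. Qed.

Lemma word_sumZl n c F : word_sum n (fun J => c * F J) = c * word_sum n F.
Proof. by rewrite /word_sum mulr_sumr. Qed.

Lemma word_sumZr n c F : word_sum n (fun J => F J * c) = word_sum n F * c.
Proof. by rewrite /word_sum mulr_suml. Qed.

Lemma word_sumD n F G :
  word_sum n (fun J => F J + G J) = word_sum n F + word_sum n G.
Proof. exact: big_split. Qed.

Lemma exchange_word_sum n (I : Type) (r : seq I) (P : pred I)
    (F : I -> seq 'I_m -> R) :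
  word_sum n (fun J => \sum_(i <- r | P i) F i J) =
  \sum_(i <- r | P i) word_sum n (F i).
Proof. exact: exchange_big. Qed.

Lemma ler_term_word_sum F J : (forall I, 0 <= F I) -> F J <= word_sum (size J) F.
Proof.
move=> F0; rewrite /word_sum (bigD1 (in_tuple J))//= lerDl.
by apply: sumr_ge0.
Qed.

Lemma word_sum_pred1 n F J :
  word_sum n (fun I => if I == J then F I else 0) =
  if n == size J then F J else 0.
Proof.
rewrite /word_sum; case: eqVneq => [->|nJ].
  rewrite (bigD1 (in_tuple J))//= eqxx big1 ?addr0// => K KJ.
  by case: eqVneq => // KJ'; case/eqP: KJ; exact/val_inj.
rewrite big1// => K _; case: eqVneq => // KJ.
by case/eqP: nJ; rewrite -KJ size_tuple.
Qed.

Lemma sum_word_sum_pred1 N F J : (forall I, 0 <= F I) ->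
  \sum_(0 <= n < N) word_sum n (fun I => if I == J then F I else 0) <= F J.
Proof.
move=> F0; under eq_bigr do rewrite word_sum_pred1.
elim: N => [|N IH]; first by rewrite big_geq.
rewrite big_nat_recr//=; case: eqVneq => [NJ|_]; last by rewrite addr0.
rewrite big_nat_cond big1 ?add0r// => i /andP[/andP[_ iN] _].
by rewrite -NJ ltn_eqF.
Qed.
(** Passage from a set of words contained in a countable list to the list
    itself, where repetitions in the list only help. *)
Lemma sum_option_words_ge (W : nat -> option (seq 'I_m)) (G : pred (seq 'I_m))
    (g : seq 'I_m -> R) (I N : nat) : (forall J, 0 <= g J) ->
  (forall J, G J -> exists2 i, (i < I)%N & W i = Some J) ->
  \sum_(0 <= n < N) word_sum n (fun J => if G J then g J else 0) <=
  \sum_(0 <= i < I) oapp g 0 (W i).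
Proof.
move=> g0 GW.
apply: (@le_trans _ _ (\sum_(0 <= i < I) \sum_(0 <= n < N)
   word_sum n (fun J => if Some J == W i then g J else 0))).
  rewrite exchange_big /=; apply: ler_sum => n _.
  rewrite -exchange_word_sum; apply: ler_word_sum => J _.
  case: ifP => [/GW[i iI WJ]|_].
    rewrite (bigD1_seq i) ?mem_index_iota ?iota_uniq//= WJ eqxx lerDl.
    by apply: sumr_ge0 => j _; case: ifP.
  by apply: sumr_ge0 => j _; case: ifP.
apply: ler_sum => i _; case: (W i) => [J|] /=; last first.
  by rewrite big1// => n _; exact: big1.
exact: sum_word_sum_pred1.
Qed.

End WordSums.

Section Compactness.
Context {R : realType} {m : nat}.
Variable A : 'M[nat]_m.

Definition admissible (J : seq 'I_m) := sorted (fun i j => A i j == 1%N) J.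

Lemma subshiftP (x : full_shift R m) :
  subshift A x <-> forall n, admissible (mkseq x n).
Proof.
split=> [Ax n|Ax k]; last first.
  have := Ax k.+2; rewrite /admissible.
  have [i0 ] : exists i0 : 'I_m, True by exists (x 0%N).
  move=> _ /(sortedP i0) /(_ k); rewrite size_mkseq ltnS => /(_ (leqnn _)).
  by rewrite !nth_mkseq// => /eqP.
apply/(sortedP (x 0%N)) => i; rewrite size_mkseq => iN.
by rewrite !nth_mkseq ?(ltnW iN)// Ax.
Qed.

Lemma admissible_cat I J : admissible (I ++ J) -> admissible I /\ admissible J.
Proof.
rewrite /admissible; case: I => [//|i I] /=.
rewrite cat_path => /andP[-> h]; split=> //; exact: path_sorted h.
Qed.

(** Compactness of the subshift, as Koenig's lemma. A word is called tall if it
    extends to admissible words of every length that avoid [W]; a tall word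
    has a tall extension by one letter, so tallness of the empty word yields
    an infinite path. The stage [N] in [W] lets a cover by infinitely many
    words be reduced to one by finitely many. *)
Lemma subshift_compact (W : nat -> seq 'I_m -> Prop) :
  (forall N N' J, (N <= N')%N -> W N J -> W N' J) ->
  (forall x : full_shift R m, subshift A x -> exists n N, W N (mkseq x n)) ->
  exists N, forall K, size K = N -> admissible K ->
    exists2 n, (n <= N)%N & W N (take n K).
Proof.
move=> Wmono cov; apply: contrapT => noN.
pose tall J := forall N, (size J <= N)%N -> exists K, [/\ size K = N, admissible K,
  take (size J) K = J & forall n, (n <= N)%N -> ~ W N (take n K)].
have tall0 : tall [::].
  move=> N _; apply: contrapT => h; apply: noN; exists N => K sK aK.
  apply: contrapT => hK; apply: h; exists K; split=> //; first by rewrite take0.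
  by move=> n nN Wn; apply: hK; exists n.
have tallS J : tall J -> exists i, tall (rcons J i).
  move=> tJ; apply: contrapT => /forallNP h.
  have /choice[Nf hNf] i : exists N, (size (rcons J i) <= N)%N /\
      ~ exists K, [/\ size K = N, admissible K,
        take (size (rcons J i)) K = rcons J i &
        forall n, (n <= N)%N -> ~ W N (take n K)].
    by have /existsNP[N /not_implyP[h1 h2]] := h i; exists N.
  (* a length that is beyond every [Nf i] and leaves room for one more letter *)
pose N := (size J + 1 + \sum_i Nf i)%N.
  have [|K [sK aK tK nK]] := tJ N; first by rewrite /N -addnA leq_addr.
  have JK : (size J < size K)%N by rewrite sK /N addn1 leq_addr.
  have [i0 ] : exists i0 : 'I_m, True by case: (K) JK => // i0; exists i0.
  move=> _; pose i := nth i0 K (size J).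
  have [h1 h2] := hNf i; apply: h2; exists (take (Nf i) K).
  have NfN : (Nf i <= N)%N by rewrite /N (bigD1 i)//= addnCA leq_addr.
  split.
  - by rewrite size_takel// sK.
  - exact: take_sorted.
  - rewrite size_rcons in h1 *.
    by rewrite take_takel// (take_nth i0)// tK.
  - move=> n nN; rewrite take_takel// => /(Wmono _ _ _ NfN).
    by apply: nK; exact: leq_trans NfN.
have [i0 _] := tallS _ tall0.
have /choice[f hf] J : exists i, tall J -> tall (rcons J i).
  by have [/tallS[i ti]|nt] := pselect (tall J); [exists i | exists i0].
pose xs n := iter n (fun J => rcons J (f J)) [::].
pose x : full_shift R m := fun n => f (xs n).
have xsE n : mkseq x n = xs n.
  by elim: n => // n IH; rewrite mkseqS IH.
have xst n : tall (xs n) by elim: n => // n IH; exact: hf.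
have sxs n : size (xs n) = n by rewrite -xsE size_mkseq.
have [|n [N WN]] := cov x.
  apply/subshiftP => n; have [K [sK aK tK _]] := xst n _ (leqnn _).
  by rewrite xsE -tK take_oversize// sK.
have [|K [sK aK tK nK]] := xst n (maxn n N); first by rewrite sxs leq_maxl.
apply: (nK n (leq_maxl _ _)); rewrite sxs in tK; rewrite tK -xsE.
exact: Wmono (leq_maxr _ _) WN.
Qed.

End Compactness.

Section MatrixNorm.
Context {R : realType} {m d : nat}.
Implicit Types B C X : 'M[R]_d.

Definition mx_ge0 B := forall a b, 0 <= B a b.

Lemma mx_norm1_ge0 B : mx_ge0 B -> 0 <= mx_norm1 B.
Proof. by move=> B0; apply: sumr_ge0 => i _; apply: sumr_ge0 => j _. Qed.

Lemma mx_ge0M B C : mx_ge0 B -> mx_ge0 C -> mx_ge0 (B *m C).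
Proof.
by move=> B0 C0 i j; rewrite mxE; apply: sumr_ge0 => k _; exact: mulr_ge0.
Qed.

Lemma mx_norm1M B C : mx_norm1 (B *m C) =
  \sum_i \sum_k B i k * \sum_j C k j.
Proof.
apply: eq_bigr => i _; under eq_bigr do rewrite mxE.
by rewrite exchange_big; apply: eq_bigr => k _; rewrite mulr_sumr.
Qed.

Lemma mx_norm1_mulmx_le B C : mx_ge0 B -> mx_ge0 C ->
  mx_norm1 (B *m C) <= mx_norm1 B * mx_norm1 C.
Proof.
move=> B0 C0; rewrite mx_norm1M mulr_suml; apply: ler_sum => i _.
rewrite mulr_suml; apply: ler_sum => k _; rewrite ler_wpM2l//.
rewrite /mx_norm1 [leRHS](bigD1 k)//= lerDl; apply: sumr_ge0 => l _.
by apply: sumr_ge0 => j _.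
Qed.

(** Inserting a strictly positive matrix between two factors loses at most a
    constant: the sum of all entries of [B X C] dominates the product of the
    sums of all entries of [B] and of [C]. *)
Lemma mx_norm1_sandwich B X C (b : R) : mx_ge0 B -> mx_ge0 C ->
  (forall k l, b <= X k l) ->
  b * (mx_norm1 B * mx_norm1 C) <= mx_norm1 (B *m X *m C).
Proof.
move=> B0 C0 bX; rewrite -mulmxA mx_norm1M mulrCA mulr_suml.
apply: ler_sum => i _; rewrite mulr_suml; apply: ler_sum => k _.
rewrite ler_wpM2l//; under eq_bigr do rewrite mxE.
rewrite exchange_big mulr_sumr; apply: ler_sum => l _ /=.
by rewrite -mulr_sumr ler_wpM2r// sumr_ge0.
Qed.

Lemma mx_norm1_is_additive : {morph @mx_norm1 R d : B C / B + C}.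
Proof.
move=> B C; rewrite /mx_norm1 -big_split; apply: eq_bigr => i _ /=.
by rewrite -big_split; apply: eq_bigr => j _; rewrite mxE.
Qed.

Lemma mx_norm1_sum (I : Type) (r : seq I) (P : pred I) (F : I -> 'M[R]_d) :
  mx_norm1 (\sum_(i <- r | P i) F i) = \sum_(i <- r | P i) mx_norm1 (F i).
Proof.
apply: (big_morph _ mx_norm1_is_additive).
by rewrite /mx_norm1 big1// => i _; rewrite big1// => j _; rewrite mxE.
Qed.

End MatrixNorm.

(** * Partition sums and pressure *)

Section PartitionFunction.
Context {R : realType} {m d : nat}.
Variables (A : 'M[nat]_m) (Ms : 'I_m -> 'M[R]_d).
Hypothesis Ms0 : forall i, mx_ge0 (Ms i).
Implicit Types (I J K : seq 'I_m) (q : R) (n k : nat).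

Definition word_norm J : R := mx_norm1 (word_mx Ms J).

Definition potential q J : R :=
  if admissible A J then word_norm J `^ q else 0.

Definition partition_sum q n : R := word_sum n (potential q).

Lemma sum_wordsE q n : \sum_(J in words A n) mx_norm1 (word_mx Ms J) `^ q =
  partition_sum q n.
Proof.
by rewrite big_mkcond; apply: eq_bigr => J _; rewrite inE.
Qed.

Lemma word_mx_cat I J : word_mx Ms (I ++ J) = word_mx Ms I *m word_mx Ms J.
Proof. by rewrite /word_mx big_cat. Qed.

Lemma word_mx_ge0 J : mx_ge0 (word_mx Ms J).
Proof.
elim: J => [|i J IH].
  by move=> a b; rewrite /word_mx big_nil mxE ler0n.
rewrite -cat1s word_mx_cat; apply: mx_ge0M => //.
by rewrite /word_mx big_seq1; exact: Ms0.
Qed.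

Lemma word_norm_ge0 J : 0 <= word_norm J.
Proof. exact/mx_norm1_ge0/word_mx_ge0. Qed.

Lemma word_norm_cat_le I J : word_norm (I ++ J) <= word_norm I * word_norm J.
Proof.
by rewrite /word_norm word_mx_cat mx_norm1_mulmx_le//; exact: word_mx_ge0.
Qed.

Lemma potential_ge0 q J : 0 <= potential q J.
Proof. by rewrite /potential; case: ifP => // _; exact: powR_ge0. Qed.

Lemma potential_cat_le q I J : 0 < q ->
  potential q (I ++ J) <= potential q I * potential q J.
Proof.
move=> q0; have [aIJ|naIJ] := boolP (admissible A (I ++ J)); last first.
  by rewrite {1}/potential (negbTE naIJ) mulr_ge0 ?potential_ge0.
have [aI aJ] := admissible_cat aIJ.
rewrite /potential aIJ aI aJ -powRM ?word_norm_ge0//.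
rewrite ge0_ler_powR ?(ltW q0) ?nnegrE ?mulr_ge0 ?word_norm_ge0//.
exact: word_norm_cat_le.
Qed.

Lemma partition_sum_ge0 q n : 0 <= partition_sum q n.
Proof. by apply: word_sum_ge0 => J _; exact: potential_ge0. Qed.

Lemma partition_sum_submul q n k : 0 < q ->
  partition_sum q (n + k) <= partition_sum q n * partition_sum q k.
Proof.
move=> q0; rewrite /partition_sum word_sum_cat -word_sumZr.
apply: ler_word_sum => I _; rewrite -word_sumZl.
by apply: ler_word_sum => J _; exact: potential_cat_le.
Qed.

Lemma potential1_powR q J : 0 < q -> potential 1 J `^ q = potential q J.
Proof.
move=> q0; rewrite /potential; case: ifP => _; last by rewrite powR0 ?gt_eqF.
by rewrite powRr1 ?word_norm_ge0.
Qed.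

Lemma admissible_between I J k (i j : 'I_m) (K : k.-tuple 'I_m) :
  admissible A (rcons I i) -> admissible A (j :: J) ->
  K \in words_between A k i j -> admissible A (rcons I i ++ K ++ j :: J).
Proof.
rewrite /words_between inE => aI aJ /andP[_]; rewrite inE /= rcons_path.
move=> /andP[iK Kj].
have step : path (fun i j => A i j == 1%N) i (K ++ j :: J).
  by rewrite cat_path iK /= Kj.
rewrite /admissible in aI *; case: I aI => [//|i0 I] /=.
by rewrite cat_path last_rcons => -> /=.
Qed.

Lemma exists_lower_bound (T : finType) (f : T -> R) : (forall t, 0 < f t) ->
  exists2 b, 0 < b & forall t, b <= f t.
Proof.
move=> f0; have S0 : 0 < 1 + \sum_t (f t)^-1.
  by rewrite ltr_pwDl// sumr_ge0// => t _; rewrite invr_ge0 ltW.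
exists (1 + \sum_t (f t)^-1)^-1; first by rewrite invr_gt0.
move=> t; rewrite -[leRHS]invrK lef_pV2 ?posrE ?invr_gt0//.
rewrite (bigD1 t)//= addrCA lerDl addr_ge0// sumr_ge0// => s _.
by rewrite invr_ge0 ltW.
Qed.

Section Positive.
Hypothesis m_gt0 : (0 < m)%N.
Hypothesis d_gt0 : (0 < d)%N.
Variable r : nat.
Hypothesis Hr : forall (i j : 'I_m) (a b : 'I_d),
      0 < (\sum_(1 <= k < r.+1) \sum_(K in words_between A k i j)
             word_mx Ms K) a b.

Let gaps I J q : R :=
  \sum_(1 <= k < r.+1) word_sum k (fun K => potential q (I ++ K ++ J)).

(** The products along all short words that join [I] to [J] add up to a
    strictly positive matrix, which is inserted between the two products. *)
Lemma potential1_quasi_mul : exists2 C, 0 < C & forall I J,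
  (0 < size I)%N -> (0 < size J)%N ->
  potential 1 I * potential 1 J <= C * gaps I J 1.
Proof.
pose T := ('I_m * 'I_m * ('I_d * 'I_d))%type.
pose X (i j : 'I_m) := \sum_(1 <= k < r.+1) \sum_(K in words_between A k i j)
             word_mx Ms K.
have [b b0 hb] := @exists_lower_bound T
  (fun t => X t.1.1 t.1.2 t.2.1 t.2.2) (fun t => Hr _ _ _ _).
exists b^-1; first by rewrite invr_gt0.
move=> I J I0 J0; have g0 : 0 <= gaps I J 1.
  by apply: sumr_ge0 => k _; apply: word_sum_ge0 => K _; exact: potential_ge0.
rewrite ler_pdivlMl//.
have [aI|naI] := boolP (admissible A I); last first.
  by rewrite /potential (negbTE naI) mul0r mulr0.
have [aJ|naJ] := boolP (admissible A J); last first.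
  by rewrite /potential (negbTE naJ) !mulr0.
rewrite /potential aI aJ !powRr1 ?word_norm_ge0//.
case/lastP: I I0 aI g0 => // I i _ aI _; case: J J0 aJ => // j J _ aJ.
apply: (@le_trans _ _ (mx_norm1
  (word_mx Ms (rcons I i) *m X i j *m word_mx Ms (j :: J)))).
  apply: mx_norm1_sandwich; try exact: word_mx_ge0.
  by move=> k l; exact: (hb ((i, j), (k, l))).
rewrite /X mulmx_sumr mulmx_suml mx_norm1_sum; apply: ler_sum => k _.
rewrite mulmx_sumr mulmx_suml mx_norm1_sum /word_sum.
rewrite [leRHS](bigID (fun K : k.-tuple 'I_m => K \in words_between A k i j)) /=.
apply: ler_wpDr.
  by apply: sumr_ge0 => K _; exact: potential_ge0.
apply: ler_sum => K Kij; rewrite /potential admissible_between//.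
by rewrite powRr1 ?word_norm_ge0// /word_norm !word_mx_cat mulmxA.
Qed.

Lemma word_sum_powR_le k (F : seq 'I_m -> R) q : 0 < q ->
  (forall K, 0 <= F K) ->
  word_sum k F `^ q <= (m ^ k)%:R `^ q * word_sum k (fun K => F K `^ q).
Proof.
move=> q0 F0; rewrite /word_sum.
have := @powR_sum_le R _ (index_enum (k.-tuple 'I_m))
  (fun K : k.-tuple 'I_m => F K) q q0.
have -> : size (index_enum (k.-tuple 'I_m)) = (m ^ k)%N.
  rewrite -[in RHS](card_ord m) -card_tuple cardT enumT.
  by rewrite [index_enum _]unlock.
by apply.
Qed.

(** Raising the previous inequality to the power [q] is harmless because the
    number of joining words is bounded independently of [I] and [J]. *)
Lemma potential_quasi_mul q : 0 < q -> exists2 C, 0 < C & forall I J,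
  (0 < size I)%N -> (0 < size J)%N ->
  potential q I * potential q J <= C * gaps I J q.
Proof.
move=> q0; have [C C0 hC] := potential1_quasi_mul.
(* [r] lengths and at most [m ^ r] joining words of each length *)
exists (C `^ q * (r%:R `^ q * (m ^ r)%:R `^ q) + 1).
  by rewrite ltr_wpDl// !mulr_ge0 ?powR_ge0.
move=> I J I0 J0; have := hC I J I0 J0.
have g0 q' : 0 <= gaps I J q'.
  by apply: sumr_ge0 => k _; apply: word_sum_ge0 => K _; exact: potential_ge0.
rewrite mulrDl mul1r => h; rewrite ler_wpDr//.
rewrite -!(potential1_powR _ q0) -powRM ?potential_ge0//.
apply: (@le_trans _ _ ((C * gaps I J 1) `^ q)).
  by rewrite ge0_ler_powR ?(ltW q0) ?nnegrE ?mulr_ge0 ?potential_ge0 ?(ltW C0) ?g0.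
rewrite powRM ?(ltW C0)// -mulrA ler_wpM2l ?powR_ge0//.
apply: le_trans (powR_sum_le _ q0 _) _.
  by move=> k; apply: word_sum_ge0 => K _; exact: potential_ge0.
rewrite size_iota subSS subn0 -mulrA ler_wpM2l ?powR_ge0//.
rewrite mulr_sumr big_nat_cond [leRHS]big_nat_cond; apply: ler_sum => k.
rewrite andbT ltnS => /andP[_ kr].
apply: le_trans (word_sum_powR_le _ q0 _) _ => [K|]; first exact: potential_ge0.
under eq_word_sum do rewrite potential1_powR//.
rewrite ler_wpM2r//; first by apply: word_sum_ge0 => K _; exact: potential_ge0.
rewrite ge0_ler_powR ?(ltW q0) ?nnegrE// ler_nat leq_pexp2l//.
Qed.

(** The words [I ++ K ++ J] are longer than [I ++ J] by at most [r] letters, and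
    submultiplicativity absorbs that excess into the constant. The empty word,
    which has no first or last letter to be joined at, is treated apart. *)
Lemma partition_sum_supmul q : 0 < q -> exists2 C, 0 < C & forall n k,
  partition_sum q n * partition_sum q k <= C * partition_sum q (n + k).
Proof.
move=> q0; have [C C0 hC] := potential_quasi_mul q0.
pose S := \sum_(1 <= l < r.+1) partition_sum q l.
have S0 : 0 <= S by apply: sumr_ge0 => l _; exact: partition_sum_ge0.
exists (C * S + partition_sum q 0 + 1).
  by rewrite ltr_wpDl// addr_ge0 ?mulr_ge0 ?partition_sum_ge0 ?(ltW C0).
have h0 n : partition_sum q 0 * partition_sum q n <=
  (C * S + partition_sum q 0 + 1) * partition_sum q n.
  apply: ler_wpM2r; first exact: partition_sum_ge0.
  by rewrite -addrA ler_wpDl ?mulr_ge0 ?(ltW C0)// lerDl.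
case=> [k|n]; first exact: h0.
case=> [|k]; first by rewrite addn0 mulrC; exact: h0.
rewrite -addrA mulrDl ler_wpDr ?mulr_ge0 ?addr_ge0 ?partition_sum_ge0//.
rewrite /partition_sum -word_sumZr.
apply: (@le_trans _ _
  (word_sum n.+1 (fun I => C * word_sum k.+1 (fun J => gaps I J q)))).
  apply: ler_word_sum => I sI; rewrite -!word_sumZl.
  by apply: ler_word_sum => J sJ; rewrite hC ?sI ?sJ.
rewrite word_sumZl -mulrA ler_wpM2l ?(ltW C0)//.
under eq_word_sum do rewrite exchange_word_sum.
rewrite exchange_word_sum mulr_suml; apply: ler_sum => l _.
apply: le_trans (partition_sum_submul _ _ q0).
rewrite addnCA /partition_sum word_sum_cat; apply: ler_word_sum => I sI.
rewrite word_sum_cat /word_sum exchange_big /=; apply: ler_sum => K _.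
by apply: ler_sum => J _.
Qed.

(** Were the sum over letters to vanish, submultiplicativity would annihilate
    all longer words too, contradicting the positivity hypothesis. *)
Lemma partition_sum_gt0 q n : 0 < q -> 0 < partition_sum q n.
Proof.
move=> q0; have S1 : 0 < partition_sum q 1.
  rewrite lt_neqAle partition_sum_ge0 andbT; apply/negP => /eqP S1.
  pose i : 'I_m := Ordinal m_gt0; pose a : 'I_d := Ordinal d_gt0.
  have := Hr i i a a; rewrite ltNge => /negP; apply.
  rewrite summxE big_nat_cond sumr_le0// => -[//|k] _.
  rewrite summxE sumr_le0// => K; rewrite 2!inE => /andP[aK _].
  have : potential q K <= 0.
    apply: le_trans (@ler_term_word_sum _ _ _ K (potential_ge0 q)) _.
    rewrite size_tuple -/(partition_sum _ _) -add1n.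
    by apply: le_trans (partition_sum_submul _ _ q0) _; rewrite -S1 mul0r.
  rewrite /potential /admissible aK => hK.
  have wK : word_norm K = 0.
    apply: (@powR_eq0_eq0 _ _ q); apply/eqP.
    by rewrite -[_ == _]andbT eq_le hK powR_ge0.
  rewrite -wK /word_norm /mx_norm1 (bigD1 a)//= (bigD1 a)//= -addrA lerDl.
  rewrite addr_ge0 ?sumr_ge0// => [? _|? _]; first exact: word_mx_ge0.
  by apply: sumr_ge0 => ? _; exact: word_mx_ge0.
have [C C0 hC] := partition_sum_supmul q0.
have Sn k : 0 < partition_sum q k.+1.
  elim: k => // k IH; have := hC k.+1 1%N; rewrite addn1 => h.
  by rewrite -(pmulr_rgt0 _ C0); apply: lt_le_trans h; exact: mulr_gt0.
case: n => // ; rewrite -(pmulr_lgt0 _ (Sn 0%N)).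
apply: lt_le_trans (partition_sum_submul _ _ q0); exact: Sn.
Qed.

Lemma pressure_bounds q : 0 < q -> exists2 C, 0 < C &
  [/\ forall n, expR (n%:R * pressure A Ms q) <= partition_sum q n,
      forall n, partition_sum q n <= C * expR (n%:R * pressure A Ms q) &
      forall n k,
        partition_sum q n * partition_sum q k <= C * partition_sum q (n + k)].
Proof.
move=> q0; have [C C0 hC] := partition_sum_supmul q0.
exists C => //.
have S0 n : 0 < partition_sum q n by exact: partition_sum_gt0.
have [||P hP] := @almost_additive R (fun n => ln (partition_sum q n)) (ln C).
- move=> n k; rewrite -lnM ?posrE// ler_ln ?posrE ?mulr_gt0//.
  exact: partition_sum_submul.
- move=> n k; rewrite -!lnM ?posrE// ler_ln ?posrE ?mulr_gt0//.
  by rewrite mulrC [leRHS]mulrC mulrC.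
have lo n : expR (n%:R * P) <= partition_sum q n.
  by have /andP[h _] := hP n; rewrite -[leRHS](lnK (S0 n)) ler_expR.
have hi n : partition_sum q n <= C * expR (n%:R * P).
  have /andP[_ h] := hP n; rewrite -[leLHS](lnK (S0 n)) -[C in leRHS](lnK C0).
  by rewrite -expRD ler_expR addrC.
suff -> : pressure A Ms q = P by [].
rewrite /pressure; under eq_fun do rewrite sum_wordsE.
suff : ((n%:R^-1)%:E * lne (partition_sum q n)%:E)%E @[n --> \oo] --> P%:E.
  by move/cvg_lim => ->.
apply/cvg_lne_growth => [n|e e0]; first exact: ltW.
have [n0 hn0] := exists_nat_mul_ge (ln C) e0.
exists n0 => n /hn0; rewrite -ler_expR lnK ?posrE// => Cn.
apply/andP; split.
  by apply: le_trans (lo n); rewrite ler_expR ler_wpM2l// gerBl ltW.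
by rewrite (le_trans (hi n))// mulrDr expRD mulrC ler_wpM2l ?expR_ge0.
Qed.

End Positive.
End PartitionFunction.

(** * Hausdorff measure on the full shift *)

Section HausdorffShift.
Context {R : realType} {m : nat}.
Hypothesis m_gt1 : (1 < m)%N.
Local Notation shift := (full_shift R m).
Local Notation logm := (ln (m%:R : R)).
Implicit Types (x y : shift) (s : R) (J : seq 'I_m) (E K : set shift).

Let logm_gt0 : 0 < logm. Proof. by rewrite ln_gt0// ltr1n. Qed.

Let expr_m_expR n : m%:R ^- n = expR (- (n%:R * logm)) :> R.
Proof.
by rewrite expRN expRM_natl lnK// posrE ltr0n; exact: leq_trans m_gt1.
Qed.

(** This is [m ^- (s * size J)], the [s]-th power of the size of a cylinder,
    up to a factor that depends on [s] only. *)
Definition cylinder_weight s J : R := expR (- ((size J)%:R * (s * logm))).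

Lemma cylinder_weight_ge0 s J : 0 <= cylinder_weight s J.
Proof. exact: expR_ge0. Qed.

Lemma shift_dist_le x y n : mkseq x n = mkseq y n ->
  shift_dist x y <= expR (- (n%:R * logm)).
Proof.
move=> xy; rewrite /shift_dist; case: pselect => [h|_]; last exact: expR_ge0.
case: ex_minnP => k xyk _; rewrite expr_m_expR ler_expR lerN2 ler_pM2r//.
rewrite ler_nat leqNgt; apply: contra xyk => /ltnW kn.
by rewrite -(nth_mkseq (x 0%N) x kn) xy nth_mkseq.
Qed.

Lemma shift_dist_lt x y n : shift_dist x y < expR (- (n%:R * logm)) ->
  mkseq x n = mkseq y n.
Proof.
move=> xy; apply: (@eq_from_nth _ (x 0%N)); rewrite !size_mkseq// => k kn.
rewrite !nth_mkseq//; apply/eqP; apply: contraTT xy => /(@shift_dist_ge R m).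
rewrite -leNgt; apply: le_trans; rewrite expr_m_expR ler_expR lerN2 ler_pM2r//.
by rewrite ler_nat.
Qed.

Lemma diam_ge0 (U : set shift) : (0 <= diam U)%E.
Proof. by apply: ereal_sup_ubound; left. Qed.

Lemma mdist_le_diam (U : set shift) x y : U x -> U y ->
  ((shift_dist x y)%:E <= diam U)%E.
Proof. by move=> Ux Uy; apply: ereal_sup_ubound; right; exists (x, y). Qed.

Lemma diam_le (U : set shift) (r : R) : 0 <= r ->
  (forall x y, U x -> U y -> shift_dist x y <= r) -> (diam U <= r%:E)%E.
Proof.
move=> r0 h; apply: ge_ereal_sup => _ [->|[[x y] [/= Ux Uy] <-]].
  by rewrite lee_fin.
by rewrite lee_fin; exact: h.
Qed.

Lemma hausdorff_weight_ge0 s (U : set shift) : (0 <= hausdorff_weight s U)%E.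
Proof. by rewrite /hausdorff_weight; case: ifP => // _; exact: poweR_ge0. Qed.

Lemma hausdorff_weight_le s (U : set shift) n : 0 <= s ->
  (diam U <= (expR (- (n%:R * logm)))%:E)%E ->
  (hausdorff_weight s U <= (expR (- (n%:R * (s * logm))))%:E)%E.
Proof.
move=> s0 Un; rewrite /hausdorff_weight; case: ifP => _.
  by rewrite lee_fin expR_ge0.
apply: (@le_trans _ _ ((expR (- (n%:R * logm)))%:E `^ s)%E).
  apply: gt0_ler_poweR => //; rewrite in_itv/= leey andbT ?diam_ge0//.
rewrite poweR_EFin -expRM lee_fin ler_expR le_eqVlt; apply/orP; left.
by apply/eqP; ring.
Qed.

Lemma hausdorff_content_ge0 s delta E : (0 <= hausdorff_content s delta E)%E.
Proof.
apply: le_ereal_inf_tmp => _ [F _ <-].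
by apply: nneseries_ge0 => i _ _; exact: hausdorff_weight_ge0.
Qed.

(** The words selected by [good] are enumerated through their [pickle] code, so
    that the infinite sum over the cover is controlled by the sums over words
    of bounded length. *)
Lemma hausdorff_measure_eq0 s E : 0 <= s ->
  (forall L eta, 0 < eta -> exists good : pred (seq 'I_m), [/\
     forall x, E x -> exists n, good (mkseq x n),
     forall J, good J -> (L <= size J)%N &
     forall N, \sum_(0 <= n < N)
       word_sum n (fun J => if good J then cylinder_weight s J else 0) <= eta]) ->
  hausdorff_measure s E = 0%E.
Proof.
move=> s0 H; apply/eqP; rewrite eq_le; apply/andP; split; last first.
  apply: le_trans (hausdorff_content_ge0 s 1 E) _.
  by apply: ereal_sup_ubound; exists 1 => //=.
apply: ge_ereal_sup => _ [delta /= d0 <-].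
apply/lee_addgt0Pr => eta eta0; rewrite add0e.
have [L hL] := exists_nat_mul_ge (- ln delta) logm_gt0.
have [good [Egood goodL goodsum]] := H L _ eta0.
pose F i : set shift := if @pickle_inv (seq 'I_m) i is Some J then
  if good J then [set x | mkseq x (size J) = J] else set0 else set0.
pose g J := if good J then cylinder_weight s J else 0.
have g0 J : 0 <= g J.
  by rewrite /g; case: ifP => // _; exact: cylinder_weight_ge0.
have diam0 : (diam (@set0 shift) <= 0%:E)%E by apply: diam_le.
have diamF J : (diam [set x : shift | mkseq x (size J) = J] <=
    (expR (- ((size J)%:R * logm)))%:E)%E.
  apply: diam_le; first exact: expR_ge0.
  by move=> x y /= xJ yJ; apply: shift_dist_le; rewrite xJ yJ.
apply: (@le_trans _ _ (\sum_(0 <= i <oo) hausdorff_weight s (F i))%E).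
  apply: ereal_inf_lbound; exists F => //; split.
    move=> i; rewrite /F; case: pickle_inv => [J|]; last first.
      by rewrite (le_trans diam0)// lee_fin ltW.
    case: ifP => [/goodL LJ|_]; last by rewrite (le_trans diam0)// lee_fin ltW.
    apply: le_trans (diamF J) _.
    by rewrite lee_fin -[leRHS](lnK d0) ler_expR lerNl hL.
  move=> x /Egood[n gx]; exists (pickle (mkseq x n)) => //.
  by rewrite /F pickleK_inv gx /= size_mkseq.
have wF i : (hausdorff_weight s (F i) <= (oapp g 0 (pickle_inv i))%:E)%E.
  rewrite /F; case: pickle_inv => [J|] /=; last by rewrite /hausdorff_weight eqxx.
  rewrite /g; case: ifP => _; last by rewrite /hausdorff_weight eqxx.
  exact: hausdorff_weight_le (diamF J).
apply: lime_le.
  by apply: is_cvg_nneseries => i _ _; exact: hausdorff_weight_ge0.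
near=> I; apply: (@le_trans _ _
  (\sum_(0 <= i < I) (oapp g 0 (@pickle_inv (seq 'I_m) i))%:E)%E).
  by apply: lee_sum => i _; exact: wF.
rewrite sumEFin lee_fin.
pose N := (\sum_(0 <= i < I) oapp size 0 (@pickle_inv (seq 'I_m) i)).+1%N.
apply: le_trans (goodsum N).
apply: (@le_trans _ _ (\sum_(0 <= i < I) \sum_(0 <= n < N)
   word_sum n (fun J => if pickle J == i then g J else 0))).
  rewrite big_nat_cond [leRHS]big_nat_cond; apply: ler_sum => i /andP[/andP[_ iI] _].
  case E1 : (pickle_inv i) => [J|] /=; last first.
    apply: sumr_ge0 => n _; apply: word_sum_ge0 => J _; case: ifP => // _; exact: g0.
  have JN : (size J < N)%N.
    by rewrite /N ltnS (bigD1_seq i) ?mem_index_iota ?iota_uniq//= E1 leq_addr.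
  rewrite (bigD1_seq (size J)) ?mem_index_iota ?iota_uniq//=.
  apply: ler_wpDr.
    apply: sumr_ge0 => n _; apply: word_sum_ge0 => K _; case: ifP => // _; exact: g0.
  have := @ler_term_word_sum R m (fun J => if pickle J == i then g J else 0) J.
  have -> : pickle J == i by have := @pickle_invK (seq 'I_m) i; rewrite E1 /= => ->.
  by apply => K; case: ifP.
rewrite exchange_big /=; apply: ler_sum => n _.
rewrite -exchange_word_sum; apply: ler_word_sum => J _.
have [JI|IJ] := ltnP (pickle J) I.
  rewrite (bigD1_seq (pickle J)) ?mem_index_iota ?iota_uniq//= eqxx.
  by rewrite big1 ?addr0// => i; rewrite eq_sym => /negbTE ->.
rewrite big_nat_cond big1; first exact: g0.
move=> i /andP[/andP[_ iI] _].
by rewrite gtn_eqF// (leq_trans iI).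
Unshelve. all: by end_near.
Qed.

(** The metric is an ultrametric with values in powers of [m], so a set of
    diameter [D] lies in a cylinder of comparable size. The slack [e] is needed
    for a single point, whose diameter is [0] although a cylinder is not. *)
Lemma set_sub_cylinder s (F : set shift) x (L : nat) (e : R) : 0 <= s -> 0 < e ->
  F x -> (diam F <= (expR (- (L.+1%:R * logm)))%:E)%E ->
  exists n, [/\ (L <= n)%N, forall y, F y -> mkseq y n = mkseq x n &
    ((expR (- (n%:R * (s * logm))))%:E <=
      (expR (s * logm))%:E * hausdorff_weight s F + e%:E)%E].
Proof.
move=> s0 e0 Fx dF.
have Fn0 : (F == set0) = false by apply/negbTE/set0P; exists x.
have [D D0 DE] : exists2 D, 0 <= D & diam F = D%:E.
  have := diam_ge0 F; move: dF; case: (diam F) => //= D _ D0.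
  by exists D; rewrite // -lee_fin.
have dD y : F y -> shift_dist y x <= D.
  by move=> Fy; have := mdist_le_diam Fy Fx; rewrite DE lee_fin.
rewrite /hausdorff_weight Fn0 DE poweR_EFin.
move: dF; rewrite DE lee_fin => dF.
(* for [D > 0] the length is fixed by [m ^- n.+1 <= D < m ^- n] *)
have [D00|Dn0] := eqVneq D 0; last first.
  have Dgt0 : 0 < D by rewrite lt_neqAle eq_sym Dn0.
  have hex : exists n, expR (- (n.+1%:R * logm)) <= D.
    have [n0 hn0] := exists_nat_mul_ge (- ln D) logm_gt0.
    by exists n0; rewrite -[leRHS](lnK Dgt0) ler_expR lerNl hn0.
  case: (ex_minnP hex) => n nD nmin.
  exists n; split.
  - by have := le_trans nD dF; rewrite ler_expR lerN2 ler_pM2r// ler_nat ltnS.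
  - move=> y /dD yD; case: n nD nmin => // n nD nmin.
    apply: shift_dist_lt; apply: (le_lt_trans yD); rewrite ltNge.
    by apply/negP => /nmin; rewrite ltnn.
  - apply: (@le_trans _ _ ((expR (s * logm))%:E * (D `^ s)%:E)%E); last first.
      by rewrite leeDl// lee_fin ltW.
    rewrite -EFinM lee_fin.
    apply: (@le_trans _ _ (expR (s * logm) * expR (- (n.+1%:R * logm)) `^ s)).
      rewrite -expRM -expRD ler_expR -natr1 le_eqVlt; apply/orP; left.
      by apply/eqP; ring.
    by rewrite ler_wpM2l ?expR_ge0// ge0_ler_powR// nnegrE expR_ge0.
have yx y : F y -> y = x.
  move=> /dD; rewrite D00 => yx; apply: (@shift_dist_eq0 R m).
  by apply/eqP; rewrite eq_le yx shift_dist_ge0.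
have [s00|sn0] := eqVneq s 0.
  exists L; split=> // [y /yx ->//|].
  rewrite s00 D00 mul0r mulr0 oppr0 expR0 powRr0 -EFinM -EFinD lee_fin mul1r.
  by rewrite lerDl ltW.
have sl0 : 0 < s * logm by rewrite mulr_gt0// lt_neqAle eq_sym sn0.
have [n0 hn0] := exists_nat_mul_ge (- ln e) sl0.
exists (maxn n0 L); split; [exact: leq_maxr | by move=> y /yx -> |].
rewrite D00 powR0// mule0 add0e lee_fin -[leRHS](lnK e0) ler_expR lerNl hn0//.
exact: leq_maxl.
Qed.

(** An arbitrary cover can be replaced by one with cylinders based at points of
    the set [K] to be covered; members of the cover that miss [K] are
    dropped. *)
Lemma hausdorff_measure0_cover s E K (L : nat) (eta : R) : 0 <= s -> 0 < eta ->
  hausdorff_measure s E = 0%E -> K `<=` E ->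
  exists W : nat -> option (seq 'I_m), [/\
    forall x, K x -> exists i n, W i = Some (mkseq x n),
    forall i J, W i = Some J ->
      (L <= size J)%N /\ exists2 x, K x & J = mkseq x (size J) &
    forall I, \sum_(0 <= i < I) oapp (cylinder_weight s) 0 (W i) <= eta].
Proof.
move=> s0 eta0 HE KE.
pose M : R := expR (s * logm).
have M0 : 0 < M by exact: expR_gt0.
pose delta : R := expR (- (L.+1%:R * logm)).
have : (hausdorff_content s delta E < (eta / 2 / M)%:E)%E.
  apply: (@le_lt_trans _ _ 0%E); last by rewrite lte_fin !divr_gt0.
  rewrite -HE; apply: ereal_sup_ubound; exists delta => //=; exact: expR_gt0.
move=> /ereal_inf_lt[_ [F [dF EF] <-] Fsum].
have /choice[W hW] i : exists o : option (seq 'I_m), [/\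
    forall x, K x -> F i x -> exists n, o = Some (mkseq x n),
    forall J, o = Some J ->
      (L <= size J)%N /\ exists2 x, K x & J = mkseq x (size J) &
    ((oapp (cylinder_weight s) 0 o)%:E <=
      M%:E * hausdorff_weight s (F i) + (eta / 2 * 2^-1 ^+ i.+1)%:E)%E].
  have e0 : 0 < eta / 2 * 2^-1 ^+ i.+1 by rewrite mulr_gt0 ?exprn_gt0 ?divr_gt0.
  have [[x [Kx Fx]]|nKF] := pselect (exists x, K x /\ F i x).
    have [n [Ln Fn wn]] := set_sub_cylinder s0 e0 Fx (dF i).
    exists (Some (mkseq x n)); split.
    - by move=> y Ky Fy; exists n; rewrite Fn.
    - by move=> J [<-]; rewrite size_mkseq; split => //; exists x.
    - by rewrite /= /cylinder_weight size_mkseq.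
  exists None; split=> // [x Kx Fx|].
    by exfalso; apply: nKF; exists x.
  by rewrite /= adde_ge0 ?mule_ge0 ?hausdorff_weight_ge0 ?lee_fin ?ltW.
exists W; split.
- move=> x Kx; have [i _ Fx] := EF _ (KE _ Kx).
  by have [h _ _] := hW i; have [n Wn] := h _ Kx Fx; exists i, n.
- by move=> i J WJ; have [_ h _] := hW i; exact: h.
move=> I; rewrite -lee_fin -sumEFin.
apply: (@le_trans _ _ (\sum_(0 <= i < I) (M%:E * hausdorff_weight s (F i) +
   (eta / 2 * 2^-1 ^+ i.+1)%:E))%E).
  by apply: lee_sum => i _; have [_ _] := hW i.
rewrite big_split/= sumEFin -mulr_sumr -ge0_sume_distrr; last first.
  by move=> i _; exact: hausdorff_weight_ge0.
rewrite [eta in leRHS](splitr eta) EFinD leeD//; last first.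
  rewrite lee_fin -[leRHS]mulr1 ler_wpM2l ?divr_ge0 ?(ltW eta0)//.
  exact: sum_pow2_le.
have -> : (eta / 2)%:E = (M%:E * (eta / 2 / M)%:E)%E.
  by rewrite -EFinM mulrCA divff ?mulr1// gt_eqF.
rewrite lee_pmul2l ?lte_fin//; apply: le_trans (ltW Fsum).
by apply: nneseries_lim_ge => *; exact: hausdorff_weight_ge0.
Qed.

Lemma hausdorff_dim_eq s0 E : 0 <= s0 ->
  (forall s, s0 < s -> hausdorff_measure s E = 0%E) ->
  (forall s, 0 <= s -> s < s0 -> hausdorff_measure s E <> 0%E) ->
  hausdorff_dim E = s0%:E.
Proof.
move=> s00 hi lo; apply/eqP; rewrite eq_le; apply/andP; split.
  apply/lee_addgt0Pr => e e0; apply: ereal_inf_lbound; exists (s0 + e) => //=.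
  by split; [rewrite addr_ge0 ?(ltW e0) | apply: hi; rewrite ltrDl].
apply: le_ereal_inf_tmp => _ [s [/= sge0 sE] <-]; rewrite lee_fin leNgt.
by apply/negP => /(lo _ sge0).
Qed.

End HausdorffShift.

(** * Level sets *)

Section LevelSets.
Context {R : realType} {m d : nat}.
Variables (A : 'M[nat]_m) (Ms : 'I_m -> 'M[R]_d).
Hypothesis Ms0 : forall i, mx_ge0 (Ms i).
Hypothesis m_gt1 : (1 < m)%N.
Hypothesis d_gt0 : (0 < d)%N.
Variable r : nat.
Hypothesis Hr : forall (i j : 'I_m) (a b : 'I_d),
      0 < (\sum_(1 <= k < r.+1) \sum_(K in words_between A k i j)
             word_mx Ms K) a b.
Implicit Types (I J K : seq 'I_m) (n k : nat).
Local Notation P := (pressure A Ms).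
Local Notation wnorm := (word_norm Ms).
Local Notation logm := (ln (m%:R : R)).

Let m_gt0 : (0 < m)%N := ltnW m_gt1.

(** Up to a constant, an upper bound for the mass that the Gibbs measure of
    parameter [q] gives to the cylinder of [J]. *)
Definition gibbs_weight (q : R) J : R :=
  potential A Ms q J * expR (- ((size J)%:R * P q)).

Lemma gibbs_weight_ge0 q J : 0 <= gibbs_weight q J.
Proof. by rewrite mulr_ge0 ?expR_ge0 ?potential_ge0. Qed.

(** Count the words [K] of a large length [N] by their prefix in [W]: those that
    extend [J] contribute at most [|M_J| ^ q] times the partition sum of order
    [N - size J], and quasi-multiplicativity bounds the latter by
    [exp (- (size J) P q)] times the partition sum of order [N]. *)
Lemma gibbs_cover q : 0 < q -> exists2 C, 0 < C &
  forall W : nat -> pred (seq 'I_m),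
  (forall N N' J, (N <= N')%N -> W N J -> W N' J) ->
  (forall x : full_shift R m, subshift A x -> exists n N, W N (mkseq x n)) ->
  exists N, 1 <= C * \sum_(0 <= n < N.+1)
    word_sum n (fun J => if W N J then gibbs_weight q J else 0).
Proof.
move=> q0; have [C C0 [lo _ sup]] := pressure_bounds Ms0 m_gt0 d_gt0 Hr q0.
exists C => // W Wmono Wcov.
have [N hN] := subshift_compact Wmono Wcov.
exists N; set S := partition_sum A Ms q.
have SN0 : 0 < S N by apply: lt_le_trans (lo N); exact: expR_gt0.
rewrite -(ler_pM2l SN0) mulr1.
pose F K n := if W N (take n K) then
  potential A Ms q (take n K) * potential A Ms q (drop n K) else 0.
have F0 K n : 0 <= F K n.
  by rewrite /F; case: ifP => // _; rewrite mulr_ge0 ?potential_ge0.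
apply: (@le_trans _ _ (word_sum N (fun K => \sum_(0 <= n < N.+1) F K n))).
  apply: ler_word_sum => K sK.
  have [aK|naK] := boolP (admissible A K); last first.
    by rewrite {1}/potential (negbTE naK) sumr_ge0.
  have [n nN WK] := hN K sK aK.
  rewrite (bigD1_seq n) ?mem_index_iota ?iota_uniq//= ler_wpDr ?sumr_ge0//.
  by rewrite /F WK -{1}(cat_take_drop n K) potential_cat_le.
rewrite exchange_word_sum mulrCA mulrA mulr_sumr.
rewrite big_nat_cond [leRHS]big_nat_cond; apply: ler_sum => n.
rewrite andbT ltnS => /andP[_ nN].
rewrite -{1}(subnKC nN) word_sum_cat -word_sumZl.
apply: ler_word_sum => J sJ.
rewrite (@eq_word_sum _ _ _ _ (fun K => if W N J then
  potential A Ms q J * potential A Ms q K else 0)); last first.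
  by move=> K _; rewrite /F take_size_cat// drop_size_cat.
case: ifP => _; last by rewrite mulr0 /word_sum big1.
rewrite word_sumZl /gibbs_weight mulrCA ler_wpM2l ?potential_ge0//.
rewrite expRN sJ ler_pdivlMr ?expR_gt0//.
have := sup n (N - n)%N; rewrite subnKC//; apply: le_trans.
by rewrite mulrC ler_wpM2r ?partition_sum_ge0.
Qed.

Variables (q alpha : R).
Hypothesis q_gt0 : 0 < q.
Hypothesis hP : is_derive q 1 P alpha.

(** Words along which the exponential growth rate is off [alpha] by more than
    [e]. *)
Definition deviant (e : R) J := ~~ (expR ((size J)%:R * (alpha - e)) <= wnorm J
  <= expR ((size J)%:R * (alpha + e))).

(** Chernoff bound by change of exponent: on [D] the weight for [q] is dominated
    by the one for [q + t], whose total mass is governed by [P (q + t)], and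
    the error in the linear approximation of [P] only uses up half of the
    gain [|t| * e]. *)
Lemma tilted_mass (t e : R) (D : pred (seq 'I_m)) : 0 < q + t ->
  `|P (q + t) - P q - t * alpha| <= e / 2 * `|t| ->
  (forall J, D J -> wnorm J `^ q <=
     wnorm J `^ (q + t) * expR (- ((size J)%:R * (t * alpha + `|t| * e)))) ->
  exists2 C, 0 < C & forall n,
    word_sum n (fun J => if D J then gibbs_weight q J else 0) <=
    C * expR (- (n%:R * (`|t| * e / 2))).
Proof.
move=> qt0 Pt hD; have [C C0 [_ hi _]] := pressure_bounds Ms0 m_gt0 d_gt0 Hr qt0.
exists C => // n.
apply: (@le_trans _ _ (partition_sum A Ms (q + t) n *
   expR (- (n%:R * (t * alpha + `|t| * e))) * expR (- (n%:R * P q)))).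
  rewrite /partition_sum -!word_sumZr; apply: ler_word_sum => J <-.
  have p0 : 0 <= potential A Ms (q + t) J by exact: potential_ge0.
  case: ifP => [/hD DJ|_]; last by rewrite !mulr_ge0 ?expR_ge0.
  rewrite /gibbs_weight ler_wpM2r ?expR_ge0// /potential.
  by case: ifP => // _; rewrite mul0r.
rewrite -mulrA -expRD.
apply: (@le_trans _ _ (C * expR (n%:R * P (q + t)) *
  expR (- (n%:R * (t * alpha + `|t| * e)) - n%:R * P q))).
  by rewrite ler_wpM2r ?expR_ge0.
rewrite -mulrA -expRD ler_wpM2l ?(ltW C0)// ler_expR.
rewrite -mulrN -mulrBr -mulrDr -mulrN ler_wpM2l//.
by move: Pt; rewrite ler_norml => /andP[_]; lra.
Qed.

(** Words with too large a norm are tilted towards [q + t], those with too small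
    a norm towards [q - t]. *)
Lemma deviant_mass (e : R) : 0 < e -> exists2 kappa, 0 < kappa &
  exists2 C, 0 < C & forall n,
    word_sum n (fun J => if deviant e J then gibbs_weight q J else 0) <=
    C * expR (- (n%:R * kappa)).
Proof.
move=> e0; have e20 : 0 < e / 2 by rewrite divr_gt0.
have [delta d0 hdelta] := is_derive_linear hP e20.
(* [t < q] keeps the exponent [q - t] positive *)
pose t := Num.min (delta / 2) (q / 2).
have t0 : 0 < t by rewrite lt_min !divr_gt0.
have td : t < delta.
  by rewrite gt_min ltr_pdivrMr// ltr_pMr// ltr1n.
have tq : t < q.
  by rewrite gt_min orbC ltr_pdivrMr// ltr_pMr// ltr1n.
exists (t * e / 2); first by rewrite divr_gt0 ?mulr_gt0.
have n0 J : 0 <= wnorm J by exact: word_norm_ge0.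
have [|||C1 C10 hC1] := @tilted_mass t e
    (fun J => expR ((size J)%:R * (alpha + e)) < wnorm J).
- by rewrite addr_gt0.
- by apply: hdelta; rewrite gtr0_norm.
- move=> J hJ; rewrite powRD; last by rewrite gt_eqF ?addr_gt0.
  rewrite -mulrA ler_peMr ?powR_ge0// expRN ler_pdivlMr ?expR_gt0// mul1r.
  rewrite gtr0_norm// -mulrDr mulrCA mulrC expRM.
  by rewrite ge0_ler_powR ?(ltW t0) ?nnegrE ?expR_ge0// ltW.
have [|||C2 C20 hC2] := @tilted_mass (- t) e
    (fun J => wnorm J < expR ((size J)%:R * (alpha - e))).
- by rewrite subr_gt0.
- by apply: hdelta; rewrite normrN gtr0_norm.
- move=> J hJ; rewrite -{1}(subrK t q) (@powRD _ _ (q - t) t); last first.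
    by rewrite subrK gt_eqF.
  rewrite ler_wpM2l ?powR_ge0// normrN gtr0_norm//.
  have -> : - ((size J)%:R * (- t * alpha + t * e)) =
    (size J)%:R * (alpha - e) * t by ring.
  rewrite expRM.
  by rewrite ge0_ler_powR ?(ltW t0) ?nnegrE ?expR_ge0// ltW.
exists (C1 + C2); first exact: addr_gt0.
move=> n; rewrite mulrDl.
have := hC1 n; have := hC2 n; rewrite normrN gtr0_norm// => h2 h1.
apply: le_trans (lerD h1 h2); rewrite -word_sumD; apply: ler_word_sum => J _.
rewrite /deviant negb_and -!ltNge.
have g0 := gibbs_weight_ge0 q J.
by do 2 case: ltP => _; rewrite ?orbT ?orbF ?addr0 ?add0r ?lerDl.
Qed.

(** Borel-Cantelli without a measure. For each [k] the deviation [1 / k.+1] is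
    excluded from a length [thr k] on, chosen so that the excluded weights add
    up to at most one half after multiplication by the constant of
    [gibbs_cover]; whatever covers the remaining points must then supply the
    other half. *)
Lemma typical_cover : exists2 C, 0 < C & exists bad : pred (seq 'I_m),
  (forall e, 0 < e -> exists n0, forall J, (n0 <= size J)%N -> ~~ bad J ->
     ~~ deviant e J) /\
  forall G : nat -> pred (seq 'I_m),
    (forall N N' J, (N <= N')%N -> G N J -> G N' J) ->
    (forall x : full_shift R m, subshift A x ->
      (forall n, ~~ bad (mkseq x n)) -> exists n N, G N (mkseq x n)) ->
    exists N, 2^-1 <= C * \sum_(0 <= n < N.+1)
      word_sum n (fun J => if G N J then gibbs_weight q J else 0).
Proof.
have [C C0 hC] := gibbs_cover q_gt0.
exists C => //.
pose mass (D : pred (seq 'I_m)) n :=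
  word_sum n (fun J => if D J then gibbs_weight q J else 0).
pose e k : R := k.+1%:R^-1.
have e0 k : 0 < e k by rewrite invr_gt0.
have /choice[thr hthr] k : exists n0, forall N,
    \sum_(n0 <= n < N) mass (deviant (e k)) n <= 2^-1 / C * 2^-1 ^+ k.+1.
  have [kappa kappa0 [B B0 hB]] := deviant_mass (e0 k).
  have eta0 : 0 < 2^-1 / C * 2^-1 ^+ k.+1 :> R.
    by rewrite !mulr_gt0 ?invr_gt0 ?exprn_gt0.
  have [n0 hn0] := geometric_tail B kappa0 eta0.
  exists n0 => N; apply: le_trans (hn0 N).
  by apply: ler_sum => n _; exact: hB.
(* requiring [k <= size J] leaves finitely many [k] to test for each word *)
pose bad J :=
  has (fun k => (thr k <= size J)%N && deviant (e k) J) (iota 0 (size J).+1).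
exists bad; split=> [eps eps0|G Gmono Gcov].
  have [k0 hk0] := exists_nat_mul_ge 1 eps0.
  exists (maxn k0 (thr k0)) => J; rewrite geq_max => /andP[kJ tJ].
  move=> /hasPn/(_ k0); rewrite mem_iota add0n ltnS kJ tJ => /(_ isT) /=.
  apply: contraNN; apply: contraNN => /andP[h1 h2].
  have ek : e k0 <= eps.
    rewrite /e -[leLHS]mul1r ler_pdivrMr ?ltr0n// mulrC.
    by rewrite (le_trans (hk0 k0 (leqnn _)))// ler_wpM2r ?ler_nat// ltW.
  apply/andP; split; first (apply: le_trans h1); last (apply: (le_trans h2)).
    by rewrite ler_expR ler_wpM2l// lerD2l lerN2.
  by rewrite ler_expR ler_wpM2l// lerD2l.
have badsum N : C * \sum_(0 <= n < N.+1) mass bad n <= 2^-1.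
  rewrite -ler_pdivlMl// mulrC.
  apply: (@le_trans _ _ (\sum_(0 <= n < N.+1) \sum_(0 <= k < N.+1 | (thr k <= n)%N)
     mass (deviant (e k)) n)).
    rewrite big_nat_cond [leRHS]big_nat_cond; apply: ler_sum => n.
    rewrite andbT ltnS => /andP[_ nN].
    rewrite -exchange_word_sum; apply: ler_word_sum => J sJ.
    have ge0 k : 0 <= (if deviant (e k) J then gibbs_weight q J else 0).
      by case: ifP => // _; exact: gibbs_weight_ge0.
    case: ifP => [/hasP[k]|_]; last by rewrite sumr_ge0.
    rewrite mem_iota add0n ltnS sJ => /andP[_ kn] /andP[tk dk].
    rewrite big_mkcond (bigD1_seq k) ?mem_index_iota ?iota_uniq//=; last first.
      by rewrite ltnS (leq_trans kn).
    rewrite tk dk lerDl sumr_ge0// => j _; case: ifP => // _; exact: ge0.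
  rewrite (exchange_big_dep xpredT)//=.
  apply: (@le_trans _ _ (\sum_(0 <= k < N.+1) 2^-1 / C * 2^-1 ^+ k.+1)).
    apply: ler_sum => k _; apply: le_trans (hthr k N.+1).
    by rewrite [leRHS](@big_nat_widenl _ _ _ _ 0%N).
  by rewrite -mulr_sumr ler_piMr ?sum_pow2_le ?divr_ge0 ?invr_ge0 ?(ltW C0).
have [N N' J NN'|x Ax|N hN] := hC (fun N J => bad J || G N J).
- by move=> /orP[->//|/(Gmono _ _ _ NN') ->]; rewrite orbT.
- have [[n bx]|nb] := pselect (exists n, bad (mkseq x n)).
    by exists n, 0%N; rewrite bx.
  have [|n [N GN]] := Gcov x Ax.
    by move=> n; apply/negP => bx; apply: nb; exists n.
  by exists n, N; rewrite GN orbT.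
exists N; set S := (X in _ <= C * X).
have : 1 <= 2^-1 + C * S.
  apply: (le_trans hN).
  apply: (@le_trans _ _ (C * \sum_(0 <= n < N.+1) mass bad n + C * S)).
    rewrite -mulrDr ler_wpM2l ?(ltW C0)// -big_split; apply: ler_sum => n _ /=.
    rewrite -word_sumD; apply: ler_word_sum => J _.
    have := gibbs_weight_ge0 q J.
    by case: (bad J); case: (G N J); rewrite /= ?addr0 ?add0r// lerDl.
  by rewrite lerD2r.
by lra.
Qed.

Lemma level_setP (x : full_shift R m) : level_set A Ms alpha x <->
  subshift A x /\ forall e, 0 < e -> exists n0, forall n, (n0 <= n)%N ->
    ~~ deviant e (mkseq x n).
Proof.
have wE := @cvg_lne_growth R (fun n => wnorm (mkseq x n)) alpha
  (fun n => word_norm_ge0 Ms0 _).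
split=> [[Ax /wE h]|[Ax h]]; split=> //.
  move=> e /h[n0 hn0]; exists n0 => n /hn0.
  by rewrite /deviant size_mkseq negbK.
apply/wE => e /h[n0 hn0]; exists n0 => n /hn0.
by rewrite /deviant size_mkseq negbK.
Qed.

Lemma typical_in_level_set (bad : pred (seq 'I_m)) (x : full_shift R m) :
  (forall e, 0 < e -> exists n0, forall J, (n0 <= size J)%N -> ~~ bad J ->
     ~~ deviant e J) ->
  subshift A x -> (forall n, ~~ bad (mkseq x n)) -> level_set A Ms alpha x.
Proof.
move=> hbad Ax nb; apply/level_setP; split=> // e /hbad[n0 hn0].
by exists n0 => n nn0; apply: hn0; rewrite ?size_mkseq.
Qed.

(** Otherwise the empty family would cover all remaining points in
    [typical_cover], but it has no weight. *)
Lemma level_set_nonempty : exists x, level_set A Ms alpha x.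
Proof.
have [C C0 [bad [hbad hG]]] := typical_cover.
apply: contrapT => nE.
have [//|x Ax nb|N] := hG (fun _ => pred0).
  by exfalso; apply: nE; exists x; exact: typical_in_level_set nb.
rewrite big1 ?mulr0; first by rewrite leNgt invr_gt0 ltr0n.
by move=> n _; rewrite /word_sum big1.
Qed.

(** Nonnegativity of the expected dimension: at a point of the level set the
    prefixes of length [n] alone contribute about [exp (n alpha q)] to the
    partition sum. *)
Lemma slope_mul_le_pressure : alpha * q <= P q.
Proof.
have [x /level_setP[Ax hx]] := level_set_nonempty.
rewrite leNgt; apply/negP => Pq.
have [C C0 [_ hi _]] := pressure_bounds Ms0 m_gt0 d_gt0 Hr q_gt0.
(* half of the gap between [alpha] and [P q / q] *)
pose e := (alpha * q - P q) / (2 * q).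
have e0 : 0 < e by rewrite divr_gt0 ?mulr_gt0// subr_gt0.
have [n0 hn0] := hx e e0.
pose kappa := (alpha - e) * q - P q.
have kE : kappa = (alpha * q - P q) / 2 by rewrite /kappa /e; field; rewrite gt_eqF.
have k0 : 0 < kappa by rewrite kE divr_gt0// subr_gt0.
have [n1 hn1] := exists_nat_mul_ge (ln C + 1) k0.
pose n := maxn n0 n1.
have /negPn/andP[] := hn0 n (leq_maxl _ _); rewrite size_mkseq => h _.
have aJ : admissible A (mkseq x n) := (subshiftP A x).1 Ax n.
have : expR (n%:R * (alpha - e)) `^ q <= C * expR (n%:R * P q).
  apply: le_trans (hi n); rewrite -[n in partition_sum _ _ _ n](size_mkseq x n).
  apply: le_trans (ler_term_word_sum _ (potential_ge0 A Ms q)).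
  rewrite /potential aJ ge0_ler_powR ?(ltW q_gt0) ?nnegrE ?expR_ge0//.
  exact: word_norm_ge0.
rewrite -expRM -[C in leRHS](lnK C0) -expRD ler_expR.
by have := hn1 n (leq_maxr _ _); rewrite /kappa; lra.
Qed.

Lemma level_set_measure0 (s : R) : 0 <= s -> P q - alpha * q < s * logm ->
  hausdorff_measure s (level_set A Ms alpha) = 0%E.
Proof.
move=> s0 hs; have [C C0 [_ hi _]] := pressure_bounds Ms0 m_gt0 d_gt0 Hr q_gt0.
(* one half of the gap pays for the deviation, the other for convergence *)
pose kappa := (s * logm - (P q - alpha * q)) / 2.
have k0 : 0 < kappa by rewrite divr_gt0// subr_gt0.
have e0 : 0 < kappa / q by rewrite divr_gt0.
apply: hausdorff_measure_eq0 => // L eta eta0.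
have [n0 hn0] := geometric_tail C k0 eta0.
pose good J := [&& (maxn L n0 <= size J)%N, admissible A J &
  expR ((size J)%:R * (alpha - kappa / q)) <= wnorm J].
exists good; split=> [x /level_setP[Ax /(_ _ e0)[n1 hn1]]|J|N].
- exists (maxn n1 (maxn L n0)); rewrite /good size_mkseq leq_maxr.
  have /negPn/andP[] := hn1 (maxn n1 (maxn L n0)) (leq_maxl _ _).
  by rewrite size_mkseq => -> _; rewrite andbT (subshiftP A x).1.
- by move=> /and3P[]; rewrite geq_max => /andP[].
apply: le_trans (hn0 N).
rewrite [leRHS](@big_nat_widenl _ _ _ _ 0%N)//= [leRHS]big_mkcond.
apply: ler_sum => n _; case: ifP => [_|nn0]; last first.
  by rewrite /word_sum big1// => J _; rewrite /good size_tuple geq_max nn0 andbF.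
apply: (@le_trans _ _ (partition_sum A Ms q n *
  expR (- (n%:R * (q * (alpha - kappa / q) + s * logm))))).
  rewrite /partition_sum -word_sumZr; apply: ler_word_sum => J sJ.
  case: ifP => [/and3P[_ aJ]|_]; last by rewrite mulr_ge0 ?potential_ge0 ?expR_ge0.
  rewrite sJ /cylinder_weight /potential aJ => wJ.
  apply: (@le_trans _ _ (expR (n%:R * (alpha - kappa / q)) `^ q *
    expR (- (n%:R * (q * (alpha - kappa / q) + s * logm))))).
    rewrite -expRM -expRD ler_expR sJ le_eqVlt; apply/orP; left; apply/eqP; ring.
  rewrite ler_wpM2r ?expR_ge0// ge0_ler_powR ?(ltW q_gt0) ?nnegrE ?expR_ge0//.
  exact: word_norm_ge0.
apply: (@le_trans _ _ (C * expR (n%:R * P q) *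
  expR (- (n%:R * (q * (alpha - kappa / q) + s * logm))))).
  by rewrite ler_wpM2r ?expR_ge0.
rewrite -mulrA -expRD ler_wpM2l ?(ltW C0)// ler_expR.
have -> : q * (alpha - kappa / q) = q * alpha - kappa by field; rewrite gt_eqF.
rewrite -!(mulrN n%:R) -mulrDr ler_wpM2l//.
by rewrite /kappa; lra.
Qed.

Lemma level_set_measure_neq0 (s : R) : 0 <= s -> s * logm < P q - alpha * q ->
  hausdorff_measure s (level_set A Ms alpha) <> 0%E.
Proof.
move=> s0 hs H0; have [C C0 [bad [hbad hG]]] := typical_cover.
pose K := [set x : full_shift R m | subshift A x /\ forall n, ~~ bad (mkseq x n)].
(* with this [e], weights of typical words are at most [cylinder_weight s] *)
pose e := (P q - alpha * q - s * logm) / q.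
have e0 : 0 < e by rewrite divr_gt0// subr_gt0.
have [n0 hn0] := hbad _ e0.
have eta0 : 0 < 4^-1 / C by rewrite divr_gt0// invr_gt0.
have KE : K `<=` level_set A Ms alpha.
  by move=> x [Ax nb]; exact: typical_in_level_set nb.
have [W [Wcov WK Wsum]] := hausdorff_measure0_cover m_gt1 n0 s0 eta0 H0 KE.
pose G N J := has (fun i => W i == Some J) (iota 0 N).
have GP N J : G N J -> exists2 i, (i < N)%N & W i = Some J.
  by move=> /hasP[i]; rewrite mem_iota => /= iN /eqP; exists i.
have [N N' J NN'|x Ax nb|N hN] := hG G.
- move=> /GP[i iN WJ]; apply/hasP; exists i; last by rewrite WJ.
  by rewrite mem_iota /= add0n (leq_trans iN).
- have [i [n Wi]] := Wcov x (conj Ax nb); exists n, i.+1.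
  by apply/hasP; exists i; rewrite ?mem_iota ?Wi/=.
have : C * \sum_(0 <= n < N.+1)
    word_sum n (fun J => if G N J then gibbs_weight q J else 0) <= C * (4^-1 / C).
  rewrite ler_wpM2l ?(ltW C0)//; apply: le_trans (Wsum N).
  apply: le_trans (sum_option_words_ge N.+1 (cylinder_weight_ge0 s) (@GP N)).
  apply: ler_sum => n _; apply: ler_word_sum => J _.
  case: ifP => // /GP[i _ /WK[sJ [x [Ax nb] xJ]]].
  have : ~~ deviant e J by apply: hn0 => //; rewrite xJ; exact: nb.
  move=> /negPn/andP[_ wJ]; rewrite /gibbs_weight /cylinder_weight.
  apply: (@le_trans _ _ (expR ((size J)%:R * (alpha + e)) `^ q *
    expR (- ((size J)%:R * P q)))).
    rewrite ler_wpM2r ?expR_ge0// /potential; case: ifP => _; last exact: powR_ge0.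
    by rewrite ge0_ler_powR ?(ltW q_gt0) ?nnegrE ?expR_ge0//; exact: word_norm_ge0.
  rewrite -expRM -expRD ler_expR le_eqVlt; apply/orP; left; apply/eqP.
  by rewrite /e; field; rewrite gt_eqF.
rewrite mulrCA divff ?gt_eqF// mulr1 => h; have := le_trans hN h; lra.
Qed.

Lemma hausdorff_dim_level_set : hausdorff_dim (level_set A Ms alpha) =
  (logm^-1 * (- alpha * q + P q))%:E.
Proof.
have -> : logm^-1 * (- alpha * q + P q) = (P q - alpha * q) / logm by ring.
have l0 : 0 < logm by rewrite ln_gt0// ltr1n.
have d0 : 0 <= (P q - alpha * q) / logm.
  by rewrite divr_ge0 ?(ltW l0)// subr_ge0 slope_mul_le_pressure.
apply: hausdorff_dim_eq => // s.
  move=> hs; apply: level_set_measure0; first exact: le_trans (ltW hs).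
  by rewrite -ltr_pdivrMr.
by move=> s0 hs; apply: level_set_measure_neq0 => //; rewrite -ltr_pdivlMr.
Qed.

End LevelSets.

(** Every letter has a successor: a vanishing row of [A] would remain a
    vanishing row in all positive powers, and the power [0] has zeros off the
    diagonal. *)
Lemma primitive_row (m : nat) (A : 'M[nat]_m) (i : 'I_m) : (1 < m)%N ->
  zero_one_mx A -> primitive_mx A -> exists j, A i j = 1%N.
Proof.
move=> m1 A01 [[|p] hp].
  have [j ij] : exists j : 'I_m, i != j.
    have /card_gt1P[x [y [_ _ xy]]] : (1 < #|'I_m|)%N by rewrite card_ord.
    by have [->|ix] := eqVneq i x; [exists y | exists x].
  by have := hp i j; rewrite expr0 mxE (negbTE ij).
apply: contrapT => /forallNP h.
have := hp i i; rewrite exprS mxE big1// => j _.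
by case: (A01 i j) => [->|/h//]; rewrite mul0r.
Qed.

Lemma subshift_from (R : realType) (m : nat) (A : 'M[nat]_m) (i : 'I_m) :
  (forall i, exists j, A i j = 1%N) ->
  exists2 x : full_shift R m, subshift A x & x 0%N = i.
Proof.
by move=> /choice[f hf]; exists (fun n => iter n f i) => // n; exact: hf.
Qed.

Theorem theorem3p4 (R : realType) (m d : nat) (hm : (2 <= m)%N) (hd : (0 < d)%N)
    (A : 'M[nat]_m) (hA01 : zero_one_mx A) (hAprim : primitive_mx A)
    (M : full_shift R m -> 'M[R]_d) (Ms : 'I_m -> 'M[R]_d)
    (hM0 : forall x, subshift A x -> forall a b, 0 <= M x a b)
    (H1 : forall (i : 'I_m) x, cylinder A [tuple i] x -> M x = Ms i)
    (H2 : exists2 r : nat, (0 < r)%N & forall (i j : 'I_m) (a b : 'I_d),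
      0 < (\sum_(1 <= k < r.+1) \sum_(K in words_between A k i j)
             word_mx Ms K) a b)
    (q alpha : R) (hq : 0 < q) (hP : is_derive q 1 (pressure A Ms) alpha) :
  hausdorff_dim (level_set A Ms alpha) =
    ((ln m%:R)^-1 * (- alpha * q + pressure A Ms q))%:E.
Proof.
have [r _ Hr] := H2.
have Ms0 i : mx_ge0 (Ms i).
  have [x Ax xi] := @subshift_from R m A i (fun j => primitive_row j hm hA01 hAprim).
  move=> a b; rewrite -(H1 i x); first exact: hM0.
  by split=> // k; rewrite ord1 xi.
exact: hausdorff_dim_level_set.
Qed.
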